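(* Let $B$ be a simple uniquely ergodic Bratteli diagram of finite rank with incidence matrices $\{F_n\}_{n\ge 1}$ and unique invariant probability measure $\mu$, and suppose $B$ has exact finite rank, telescoped so that there is $\delta>0$ with $\mu(X_v^{(n)})\ge\delta$ for all $n\ge1$ and all $v\in V_n$. (1) Then $$\inf_{v,w,n}\frac{\mu(B_n(v))}{\mu(B_n(w))}>0\quad\text{if and only if}\quad \inf_{v,w,n}\frac{h_v^{(n)}}{h_w^{(n)}}>0,$$ where $B_n(w)$ is the base of the tower $X_w^{(n)}$ and $h^{(n)}=F_{n-1}\cdots F_1\overline 1$ is the vector of tower heights, $\overline 1=(1,\dots,1)^T$. (2) Suppose either condition in (1) holds. Let $B$ be further telescoped, keeping level $1$, so that (denoting the new incidence matrices again by $F_n$) there is a non-negative probability vector $\xi$ with $$\lim_{m\to\infty}\frac{F_m\cdots F_nx}{\|F_m\cdots F_nx\|_1}=\xi\qquad\text{for all } n\geq 1 \text{ and all non-zero } x\in\mathbb R^d_+ .$$ Then $\xi$ is strictly positive and, after an appropriate further telescoping (keeping level $1$), $$h_w^{(n)}\sim \xi_w\|F_{n-1}\cdots F_1\|_1\quad\text{and}\quad \mu(B_n(w))\sim\frac{\rho_w}{\|F_{n-1}\cdots F_1\|_1}\qquad(n\to\infty)$$ for every vertex $w$ and some strictly positive vector $\rho=(\rho_w)$.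
   Context: A Bratteli diagram $B=(V,E)$ is an infinite graph with vertex set $V=\bigsqcup_{i\ge 0}V_i$ and edge set $E=\bigsqcup_{i\ge 1}E_i$, all $V_i,E_i$ finite, $V_0=\{v_0\}$, with range and source maps $r(E_i)=V_i$, $s(E_i)=V_{i-1}$, $s^{-1}(v)\ne\emptyset$ for all $v$ and $r^{-1}(v)\ne\emptyset$ for $v\ne v_0$. $X_B$ is the space of infinite paths from $v_0$, topologized by cylinder sets. Incidence matrices: $F_n=(f^{(n)}_{v,w})_{v\in V_{n+1},w\in V_n}$, $f^{(n)}_{v,w}$ = number of edges between $w\in V_n$ and $v\in V_{n+1}$. $B$ is simple if for every $n$ there is $m>n$ such that every vertex of $V_n$ is connected to every vertex of $V_m$ by a path. Telescoping along $1=n_1<n_2<\cdots$ (together with level $0$): keep only these levels and take finite paths between consecutive kept levels as edges; the new incidence matrices are $F_{n_{k+1}-1}\cdots F_{n_k}$. Standing assumptions: every level $V_n$, $n\ge1$, has the same number $d$ of vertices and is identified with $\{1,\dots,d\}$; there is exactly one edge from $v_0$ to each vertex of $V_1$; $X_B$ has no isolated points; the tail equivalence relation (paths agreeing from some level on) has no finite classes. An invariant measure is a non-atomic Borel measure on $X_B$ giving equal mass to the cylinder sets of any two finite paths from $v_0$ with the same range; $B$ is uniquely ergodic if it has a unique invariant probability measure. For $w\in V_n$: $X_w^{(n)}$ is the set of infinite paths through $w$ at level $n$, $h^{(n)}_w$ is the number of finite paths from $v_0$ to $w$, and $B_n(w)$ is the cylinder set of any one fixed finite path from $v_0$ to $w$,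 so $\mu(X_w^{(n)})=h_w^{(n)}\mu(B_n(w))$. Exact finite rank means that for some $\delta>0$, after a telescoping, $\mu(X_v^{(n)})\ge\delta$ for all $n\ge 1$, $v\in V_n$. Norms: $\|v\|_1=\sum_i|v_i|$ for vectors and $\|A\|_1=\sum_{i,j}|a_{i,j}|$ for matrices. $x_n\sim y_n$ means $x_n/y_n\to1$. *)

(* Defs.v *)
From HB Require Import structures.
From mathcomp Require Import all_boot all_order all_algebra.
From mathcomp Require Import all_classical all_reals all_analysis.

Set Implicit Arguments.
Unset Strict Implicit.
Unset Printing Implicit Defensive.

Import Order.TTheory GRing.Theory Num.Theory.
Import numFieldTopology.Exports.

Local Open Scope classical_set_scope.
Local Open Scope ring_scope.

(* The vertex set V_n is identified with {0, ..., vcard n - 1}; [edge n] is the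
   edge set E_{n+1} between V_n and V_{n+1}. Vertices are compared through
   their labels in nat, so that 'I_d can serve as index set of all the levels
   V_n, n >= 1, once [vcard n = d]. *)
Record bratteli := Bratteli {
  vcard : nat -> nat;
  edge : nat -> finType;
  source : forall n, edge n -> 'I_(vcard n);
  target : forall n, edge n -> 'I_(vcard n.+1);
  vcard0 : vcard 0 = 1%N;
  source_onto : forall n (w : 'I_(vcard n)), exists e : edge n, source e = w;
  target_onto : forall n (v : 'I_(vcard n.+1)), exists e : edge n, target e = v
}.

Arguments edge : clear implicits.
Arguments vcard : clear implicits.

(* V_0 is a singleton, so every composable sequence starts at v_0. *)
Record ipath (B : bratteli) := IPath {
  edge_at : forall n, edge B n;
  edge_atS : forall n, target (edge_at n) = source (edge_at n.+1)
}.

Definition level_vertex (B : bratteli) (x : ipath B) (n : nat) :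
    'I_(vcard B n) := source (edge_at x n).

Lemma ipath_inhabited (B : bratteli) : exists x : ipath B, True.
Proof.
pose nxt n (e : edge B n) : edge B n.+1 :=
  sval (cid (source_onto (target e))).
have hnxt n (e : edge B n) : source (nxt n e) = target e.
  by rewrite /nxt; case: cid.
have lt0 : (0 < vcard B 0)%N by rewrite vcard0.
have [e0 _] := source_onto (Ordinal lt0).
pose f := nat_rect (fun n => edge B n) e0 nxt.
have hf n : target (f n) = source (f n.+1) by rewrite /= hnxt.
by exists (IPath hf).
Qed.

HB.instance Definition _ (B : bratteli) := gen_eqMixin (ipath B).
HB.instance Definition _ (B : bratteli) := gen_choiceMixin (ipath B).
HB.instance Definition _ (B : bratteli) :=
  isPointed.Build (ipath B) (sval (cid (ipath_inhabited B))).

Definition cylinder_at (B : bratteli) (nx : nat * ipath B) : set (ipath B) :=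
  [set y | forall i, (i < nx.1)%N -> edge_at y i = edge_at nx.2 i].

Lemma cylinder_at_cover (B : bratteli) :
  \bigcup_(nx in [set: nat * ipath B]) cylinder_at nx = setT.
Proof. by apply/seteqP; split=> // x _; exists (0%N, x). Qed.

Lemma cylinder_at_join (B : bratteli) (p q : nat * ipath B) (t : ipath B) :
  [set: nat * ipath B] p -> [set: nat * ipath B] q ->
  cylinder_at p t -> cylinder_at q t ->
  exists r, [/\ [set: nat * ipath B] r, cylinder_at r t
    & cylinder_at r `<=` cylinder_at p `&` cylinder_at q].
Proof.
move=> _ _ pt qt; exists (maxn p.1 q.1, t); split=> // y hy.
by split=> i hi; rewrite hy /= ?leq_max ?hi ?orbT //; [exact: pt|exact: qt].
Qed.

HB.instance Definition _ (B : bratteli) :=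
  isBaseTopological.Build (ipath B) (@cylinder_at_cover B)
    (@cylinder_at_join B).

(* X_B with its Borel sigma-algebra. *)
Definition path_space (B : bratteli) :=
  g_sigma_algebraType (@open (ipath B)).

Definition no_isolated_points (B : bratteli) : Prop :=
  forall x : ipath B, ~ open [set x].

Definition tail_equiv (B : bratteli) (x y : ipath B) : Prop :=
  exists N, forall n, (N <= n)%N -> edge_at x n = edge_at y n.

Definition no_finite_tail_class (B : bratteli) : Prop :=
  forall x : ipath B, infinite_set [set y | tail_equiv x y].

Definition one_root_edge (B : bratteli) : Prop :=
  forall v : 'I_(vcard B 1), #|[set e : edge B 0 | target e == v]%SET| = 1%N.

(* The finite paths of length k from the vertex (labelled) w of V_m to the
   vertex v of V_{m+k}. For k = 0 the end points are not constrained; only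
   k > 0 is meaningful. *)
Definition fpaths (B : bratteli) (m k w v : nat) :
    {set {dffun forall i : 'I_k, edge B (m + i)}} :=
  [set p : {dffun forall i : 'I_k, edge B (m + i)} |
    [&& [forall i : 'I_k, forall j : 'I_k, (j == i.+1 :> nat) ==>
          (target (p i) == source (p j) :> nat)],
        [forall i : 'I_k, (i == 0 :> nat) ==> (source (p i) == w :> nat)]
      & [forall i : 'I_k, (i.+1 == k :> nat) ==>
          (target (p i) == v :> nat)]]]%SET.

Definition simple_bratteli (B : bratteli) : Prop :=
  forall n, exists k, (0 < k)%N /\
    forall (w : 'I_(vcard B n)) (v : 'I_(vcard B (n + k))),
      fpaths B n k w v != finset.set0.

(* The finite paths from v_0 to the vertex w of V_n, n >= 1. *)
Definition root_paths (B : bratteli) (n w : nat) := fpaths B 0 n 0 w.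

Definition height (B : bratteli) (n w : nat) : nat := #|root_paths B n w|.

Definition cylinder (B : bratteli) (n : nat)
    (p : {dffun forall i : 'I_n, edge B (0 + i)}) : set (path_space B) :=
  [set x : ipath B | forall i : 'I_n, edge_at x i = p i].

Definition tower (B : bratteli) (n w : nat) : set (path_space B) :=
  [set x : ipath B | level_vertex x n = w :> nat].

Definition tower_base (B : bratteli) (n w : nat) : set (path_space B) :=
  if [pick p in root_paths B n w] is Some p then cylinder p else set0.

Arguments tower : clear implicits.
Arguments tower_base : clear implicits.

Definition nonatomic d (T : measurableType d) (R : realType)
    (mu : {measure set T -> \bar R}) : Prop :=
  forall A, measurable A -> (0 < mu A)%E ->
    exists C, [/\ measurable C, C `<=` A, (0 < mu C)%E & (mu C < mu A)%E].

Definition invariant_measure (R : realType) (B : bratteli)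
    (mu : {measure set (path_space B) -> \bar R}) : Prop :=
  nonatomic mu /\
  forall (n : nat) (w : 'I_(vcard B n)), (0 < n)%N ->
    {in root_paths B n w &, forall p q, mu (cylinder p) = mu (cylinder q)}.

Definition uniquely_ergodic (R : realType) (B : bratteli) : Prop :=
  exists mu : probability (path_space B) R, invariant_measure mu /\
    forall nu : probability (path_space B) R, invariant_measure nu ->
      forall A, measurable A -> nu A = mu A.

Definition base_mass (R : realType) (B : bratteli)
    (mu : {measure set (path_space B) -> \bar R}) (n w : nat) : R :=
  fine (mu (tower_base B n w)).

(* F_n, for n >= 1, when V_n and V_{n+1} both have d vertices. *)
Definition incidence (R : realType) (B : bratteli) (d n : nat) : 'M[R]_d :=
  \matrix_(v, w) #|[set e : edge B n |
    (source e == w :> nat) && (target e == v :> nat)]%SET|%:R.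

(* F_{n-1} ... F_m, the identity matrix when n <= m. *)
Fixpoint mxprod (R : realType) (d : nat) (F : nat -> 'M[R]_d) (m n : nat) :
    'M[R]_d :=
  if n is n'.+1 then
    if (m <= n')%N then F n' *m mxprod F m n' else 1%:M
  else 1%:M.

Definition l1norm (R : realType) (m n : nat) (A : 'M[R]_(m, n)) : R :=
  \sum_i \sum_j `|A i j|.

(* The levels t k are kept. Level 0 is kept as level 0, level 1 as level 1. *)
Definition telescoping (t : nat -> nat) : Prop :=
  [/\ t 0 = 0, t 1 = 1 & forall k, t k < t k.+1]%N.

(* Incidence matrices of the telescoped diagram. Its level k is the level t k
   of the original one, with the same paths from v_0, hence the same heights
   h^(t k), the same path space, towers and tower bases. *)
Definition telescoped (R : realType) (d : nat) (F : nat -> 'M[R]_d)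
    (t : nat -> nat) (k : nat) : 'M[R]_d :=
  mxprod F (t k) (t k.+1).

Definition bounded_base_ratio (R : realType) (B : bratteli) (d : nat)
    (mu : {measure set (path_space B) -> \bar R}) : Prop :=
  0 < inf [set r : R | exists n (v w : 'I_d),
    (1 <= n)%N /\ r = base_mass mu n v / base_mass mu n w].

Definition bounded_height_ratio (R : realType) (B : bratteli) (d : nat) :
    Prop :=
  0 < inf [set r : R | exists n (v w : 'I_d),
    (1 <= n)%N /\ r = (height B n v)%:R / (height B n w)%:R].

Definition asymp_equiv (R : realType) (u v : nat -> R) : Prop :=
  (fun n => u n / v n) @ \oo --> (1 : R).

(* Main.v *)
(* Invariance makes the mass of a tower equal to height times base mass, and
   this product stays in [delta, 1]. Hence base-mass ratios are comparable to
   inverse height ratios, which is part (1). For part (2), the height vector at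
   level t m is the product of the incidence matrices applied to the all-ones
   vector, so h / ||h||_1 tends to xi, whose entries inherit a positive lower
   bound from the bounded height ratios. The vectors of tower masses lie in the
   compact cube [delta, 1]^d, so they converge to some tau along a further
   telescoping, and base mass = tower mass / height gives the asymptotics with
   rho = tau / xi. *)
Require Import Defs.
From HB Require Import structures.
From mathcomp Require Import all_boot all_order all_algebra.
From mathcomp Require Import all_classical all_reals all_analysis.

Import Order.TTheory GRing.Theory Num.Theory.
Import numFieldTopology.Exports.

Local Open Scope classical_set_scope.
Local Open Scope ring_scope.

Set Implicit Arguments.
Unset Strict Implicit.
Unset Printing Implicit Defensive.

(** * Finite paths from the root and the recursion for tower heights *)

Notation finite_path B n := {dffun forall i : 'I_n, edge B (0 + i)}.

Lemma source_root (B : bratteli) k (e : edge B k) :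
  k = 0%N -> source e = 0%N :> nat.
Proof.
move=> k0; apply/eqP; rewrite -leqn0 -ltnS.
by apply: leq_trans (ltn_ord (source e)) _; rewrite k0 vcard0.
Qed.

(** Since V_0 has a single vertex, labelled 0, the condition on the source of the first edge holds
    automatically and drops out. *)
Lemma root_pathsP (B : bratteli) n w (p : finite_path B n) :
  reflect ((forall i j : 'I_n, j = i.+1 :> nat ->
             target (p i) = source (p j) :> nat) /\
           (forall i : 'I_n, i.+1 = n -> target (p i) = w :> nat))
          (p \in root_paths B n w).
Proof.
rewrite inE; apply: (iffP and3P);
  first move=> [/'forall_'forall_implyP h1 _ /'forall_implyP h2].
  by split=> [i j /eqP ij|i /eqP ik]; apply/eqP; [exact: h1|exact: h2].
move=> [h1 h2]; split.
- by apply/'forall_'forall_implyP => i j /eqP ij; apply/eqP; exact: h1.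
- by apply/'forall_implyP => i /eqP i0; apply/eqP; exact: source_root.
- by apply/'forall_implyP => i /eqP ik; apply/eqP; exact: h2.
Qed.

Lemma ord_max_eq n (i : 'I_n.+1) : ~ (i < n)%N -> n = i.
Proof.
move=> /negP; rewrite -leqNgt => ni.
by apply/eqP; rewrite eqn_leq ni -ltnS ltn_ord.
Qed.

(** Edge types depend on the level, so at the last index the new edge [e : edge B n] is transported
    along the equation [n = i]. *)
Definition rcons_path (B : bratteli) n (q : finite_path B n) (e : edge B n) :
    finite_path B n.+1 :=
  finfun (fun i : 'I_n.+1 =>
    match (i < n)%N =P true return edge B (0 + i) with
    | ReflectT h => q (Ordinal h)
    | ReflectF h => ecast k (edge B k) (ord_max_eq h) e
    end).

Definition belast_path (B : bratteli) n (p : finite_path B n.+1) :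
    finite_path B n :=
  finfun (fun i : 'I_n => p (widen_ord (leqnSn n) i)).

Lemma rcons_path_widen (B : bratteli) n (q : finite_path B n) e (i : 'I_n) :
  rcons_path q e (widen_ord (leqnSn n) i) = q i.
Proof.
rewrite ffunE; case: eqP => [h|]; last by case; rewrite /= ltn_ord.
by case: i h => i hi h; rewrite (bool_irrelevance h hi).
Qed.

Lemma rcons_path_max (B : bratteli) n (q : finite_path B n) e :
  rcons_path q e ord_max = e.
Proof.
rewrite ffunE; case: eqP => [h|h]; first by exfalso; rewrite /= ltnn in h.
by rewrite (eq_irrelevance (ord_max_eq h) (erefl n)).
Qed.

Variant ord_rcons_spec n : 'I_n.+1 -> Type :=
  | OrdRconsWiden j : ord_rcons_spec (widen_ord (leqnSn n) j)
  | OrdRconsMax : ord_rcons_spec ord_max.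

Lemma ord_rconsP n (i : 'I_n.+1) : ord_rcons_spec i.
Proof.
case: (ltnP i n) => [h|h].
  suff -> : i = widen_ord (leqnSn n) (Ordinal h) by constructor.
  exact: val_inj.
suff -> : i = ord_max by constructor.
by apply/val_inj/eqP; rewrite /= eqn_leq h -ltnS ltn_ord.
Qed.

Lemma rcons_belast_path (B : bratteli) n (p : finite_path B n.+1) :
  rcons_path (belast_path p) (p ord_max) = p.
Proof.
apply/ffunP => i; case: (ord_rconsP i) => [j|].
  by rewrite rcons_path_widen ffunE.
exact: rcons_path_max.
Qed.

Lemma rcons_path_inj (B : bratteli) n e :
  injective (fun q : finite_path B n => rcons_path q e).
Proof.
move=> q q' qq'; apply/ffunP => i.
by rewrite -(rcons_path_widen q e) qq' rcons_path_widen.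
Qed.

Lemma mem_root_paths_rcons (B : bratteli) n w (q : finite_path B n) e :
  (rcons_path q e \in root_paths B n.+1 w) =
  (q \in root_paths B n (source e)) && (target e == w :> nat).
Proof.
apply/root_pathsP/andP => [[h1 h2]|[/root_pathsP[h1 h2] /eqP ew]]; last first.
  split=> i; last first.
    case: (ord_rconsP i) => [j /= /succn_inj jn|_]; last first.
      by rewrite rcons_path_max.
    by exfalso; have := ltn_ord j; rewrite jn ltnn.
  move=> j; case: (ord_rconsP i) => [i'|] /=; last first.
    by move=> jn; exfalso; have := ltn_ord j; rewrite jn ltnn.
  rewrite rcons_path_widen; case: (ord_rconsP j) => [j'|] /= ij.
    by rewrite rcons_path_widen; exact: h1.
  by rewrite rcons_path_max; exact: h2.
split; last by rewrite -(h2 ord_max) // rcons_path_max.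
apply/root_pathsP; split=> [i j ij|i ik].
  have := h1 (widen_ord (leqnSn n) i) (widen_ord (leqnSn n) j) ij.
  by rewrite !rcons_path_widen.
have := h1 (widen_ord (leqnSn n) i) ord_max (esym ik).
by rewrite rcons_path_widen rcons_path_max.
Qed.

(** Paths are sorted by their last edge [e]; deleting it is a bijection onto the paths from the root
    to the source of [e]. *)
Lemma height_rec (B : bratteli) n w :
  height B n.+1 w =
  (\sum_(e : edge B n | target e == w :> nat) height B n (source e))%N.
Proof.
rewrite /height -sum1_card.
rewrite (partition_big (fun p : finite_path B n.+1 => p ord_max)
  (fun e => target e == w :> nat)) /=; last first.
  move=> p; rewrite -{1}(rcons_belast_path p) mem_root_paths_rcons.
  by case/andP.
apply: eq_bigr => e ew.
rewrite -(card_imset _ (@rcons_path_inj B n e)) -sum1_card; apply: eq_bigl => p.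
apply/andP/imsetP => [[pw /eqP pe]|[q qr ->]]; last first.
  by rewrite mem_root_paths_rcons qr ew rcons_path_max.
exists (belast_path p); last by rewrite -pe rcons_belast_path.
move: pw; rewrite -{1}(rcons_belast_path p) mem_root_paths_rcons pe.
by case/andP.
Qed.

(** The empty path satisfies the end-point conditions vacuously, so it is counted for every label
    [w]. *)
Lemma height0 (B : bratteli) w : height B 0 w = 1%N.
Proof.
have -> : height B 0 w = #|{: finite_path B 0}|.
  by apply: eq_card => p; rewrite [RHS]inE; apply/root_pathsP; split => [[]|[]].
rewrite card_dep_ffun /image_mem.
by have -> : enum 'I_0 = [::] by apply: size0nil; rewrite size_enum_ord.
Qed.

Lemma height1 (B : bratteli) (w : 'I_(vcard B 1)) :
  one_root_edge B -> height B 1 w = 1%N.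
Proof.
move=> rootB; rewrite height_rec (eq_bigr (fun=> 1%N)) => [|*]; last first.
  exact: height0.
rewrite sum1_card; apply: etrans (rootB w).
by apply: eq_card => e; rewrite !inE.
Qed.

(** Grouping the edges of [height_rec] by their source turns the recursion into h^(n+1) = F_n
    h^(n). *)
Lemma height_incidence (R : realType) (B : bratteli) d n (v : 'I_d) :
  vcard B n = d ->
  (height B n.+1 v)%:R =
    \sum_(w < d) incidence R B d n v w * (height B n w)%:R.
Proof.
move=> vd; subst d; rewrite height_rec (partition_big (@source B n) xpredT) //=.
rewrite natr_sum; apply: eq_bigr => w _.
rewrite (eq_bigr (fun=> height B n w)); last by move=> e /andP[_ /eqP ->].
rewrite sum_nat_const natrM mxE; congr (_%:R * _).
by apply: eq_card => e; rewrite !inE andbC.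
Qed.

(** * Measurability and mass of towers *)

Lemma open_cylinder_at (B : bratteli) (nx : nat * ipath B) :
  open (cylinder_at nx).
Proof. by exists [set nx] => //; exact: bigcup_set1. Qed.

Lemma measurable_cylinder (B : bratteli) n (p : finite_path B n) :
  measurable (cylinder p).
Proof.
apply: sub_sigma_algebra.
suff -> : cylinder p = \bigcup_(x in cylinder p) cylinder_at (n, x : ipath B).
  by apply: bigcup_open => x _; exact: open_cylinder_at.
apply/seteqP; split=> [x px|x [y py xy] i]; first by exists x.
by rewrite -py; apply: xy => /=; exact: ltn_ord.
Qed.

(** A tower is read off the source of edge [n], a cylinder fixes only the edges before it; for
    [n > 0] composability identifies that source with the target of the last fixed edge. *)
Lemma tower_cylinders (B : bratteli) n w : (0 < n)%N ->
  tower B n w = \bigcup_(p in [set` enum (root_paths B n w)]) cylinder p.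
Proof.
case: n => // n _; apply/seteqP; split=> [x xw|x [p]]; last first.
  rewrite /= mem_enum => /root_pathsP[_ pw] px.
  rewrite /tower /= /level_vertex -(edge_atS x n).
  have -> : edge_at (x : ipath B) n = p ord_max by exact: (px ord_max).
  exact: (pw ord_max erefl).
exists (finfun (fun i : 'I_n.+1 => edge_at x i)) => [|i]; last by rewrite ffunE.
rewrite /= mem_enum.
apply/root_pathsP; split=> [i j ij|i /succn_inj ik]; rewrite !ffunE.
  by rewrite (edge_atS x i) [nat_of_ord j]ij.
by rewrite -xw /level_vertex -(edge_atS x n) [nat_of_ord i]ik.
Qed.

Lemma measurable_tower (B : bratteli) n w : (0 < n)%N ->
  measurable (tower B n w).
Proof.
move=> n0; rewrite tower_cylinders //.
by apply: fin_bigcup_measurable => // p _; exact: measurable_cylinder.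
Qed.

(** By invariance, the path picked in [tower_base] does not matter. *)
Lemma mu_tower_base (R : realType) (B : bratteli)
    (mu : {measure set (path_space B) -> \bar R}) n (w : 'I_(vcard B n)) p :
  invariant_measure mu -> (0 < n)%N -> p \in root_paths B n w ->
  mu (cylinder p) = mu (tower_base B n w).
Proof.
move=> [_ inv] n0 pw; rewrite /tower_base; case: pickP => [q qw|/(_ p)].
  exact: inv pw qw.
by rewrite pw.
Qed.

(** The tower is the disjoint union of as many cylinders as its height, all of the mass of the base.
    This mass is finite, so [fine] loses nothing. *)
Lemma mu_towerE (R : realType) (B : bratteli)
    (mu : probability (path_space B) R) d n (w : 'I_d) :
  vcard B n = d -> invariant_measure mu -> (0 < n)%N ->
  mu (tower B n w) = ((height B n w)%:R * base_mass mu n w)%:E.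
Proof.
move=> vd inv n0; subst d; rewrite tower_cylinders //.
rewrite measure_fin_bigcup //; last 2 first.
- move=> p q _ _ [x [px qx]]; apply/ffunP => i.
  by rewrite -px qx.
- by move=> p _; exact: measurable_cylinder.
rewrite -fsbig_seq ?enum_uniq // big_enum /=.
have fin_base : mu (tower_base B n w) \is a fin_num.
  rewrite fin_num_measure // /tower_base; case: pickP => [p _|_] //.
  exact: measurable_cylinder.
rewrite (eq_bigr (fun=> (base_mass mu n w)%:E)); last first.
  by move=> p pw; rewrite fineK //; exact: mu_tower_base inv n0 pw.
by rewrite sumEFin sumr_const mulr_natl.
Qed.

(** * Products of incidence matrices and height vectors *)

Lemma mxprodnn (R : realType) d (F : nat -> 'M[R]_d) m : mxprod F m m = 1%:M.
Proof. by case: m => //= m; rewrite ltnn. Qed.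

Lemma mxprodS (R : realType) d (F : nat -> 'M[R]_d) m n : (m <= n)%N ->
  mxprod F m n.+1 = F n *m mxprod F m n.
Proof. by move=> /= ->. Qed.

Lemma mxprod_trans (R : realType) d (F : nat -> 'M[R]_d) m k n :
  (m <= k)%N -> (k <= n)%N -> mxprod F k n *m mxprod F m k = mxprod F m n.
Proof.
move=> mk /subnKC <-; elim: (n - k)%N => [|j IH].
  by rewrite addn0 mxprodnn mul1mx.
by rewrite addnS !mxprodS ?leq_addr ?(leq_trans mk) ?leq_addr // -mulmxA IH.
Qed.

(** The blocks between consecutive kept levels concatenate without gaps. *)
Lemma mxprod_telescoped (R : realType) d (F : nat -> 'M[R]_d) t m n :
  telescoping t -> (m <= n)%N ->
  mxprod (telescoped F t) m n = mxprod F (t m) (t n).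
Proof.
move=> [_ _ tS] /subnKC <-; elim: (n - m)%N => [|j IH].
  by rewrite addn0 !mxprodnn.
rewrite addnS mxprodS ?leq_addr // IH mxprod_trans ?(ltnW (tS _)) //.
have t_incr : {homo t : i k / (i <= k)%N}.
  by apply: homo_leq => [//|k i l|i]; [exact: leq_trans|exact: ltnW].
by rewrite t_incr // leq_addr.
Qed.

Lemma mxprod_ge0 (R : realType) d (F : nat -> 'M[R]_d) m n :
  (forall k i j, 0 <= F k i j) -> forall i j, 0 <= mxprod F m n i j.
Proof.
move=> F0; elim: n => [|n IH] i j /=; first by rewrite mxE ler0n.
case: ifP => _; last by rewrite mxE ler0n.
by rewrite mxE sumr_ge0 // => k _; rewrite mulr_ge0.
Qed.

(** The entries of [A *m const_mx 1] are the row sums of [A]. This converts norms of matrix products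
    into norms of height vectors. *)
Lemma l1norm_mul1 (R : realType) m n (A : 'M[R]_(m, n)) :
  (forall i j, 0 <= A i j) -> l1norm A = l1norm (A *m const_mx 1 : 'cV_m).
Proof.
move=> A0; apply: eq_bigr => i _; rewrite big_ord1 mxE ger0_norm; last first.
  by apply: sumr_ge0 => j _; rewrite mxE mulr1.
by apply: eq_bigr => j _; rewrite ger0_norm // mxE mulr1.
Qed.

Definition heights (R : realType) (B : bratteli) d n : 'cV[R]_d :=
  \col_w (height B n w)%:R.

(** Induction from level 1, where the single edge from the root to each vertex makes every height
    1. *)
Lemma heights_mxprod (R : realType) (B : bratteli) d n :
  (forall n, (1 <= n)%N -> vcard B n = d) -> one_root_edge B -> (1 <= n)%N ->
  mxprod (incidence R B d) 1 n *m const_mx 1 = heights R B d n.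
Proof.
move=> rankB rootB; elim: n => // -[_ _|n IH _].
  rewrite mxprodnn mul1mx; apply/colP => w; rewrite !mxE.
  by have vd := rankB 1%N isT; subst d; rewrite height1.
rewrite mxprodS // -mulmxA IH //; apply/colP => v.
rewrite [RHS]mxE (height_incidence R v (rankB n.+1 isT)) mxE.
by apply: eq_bigr => w _; rewrite [heights _ _ _ _ _ _]mxE.
Qed.

Lemma l1norm_incidence (R : realType) (B : bratteli) d n :
  (forall n, (1 <= n)%N -> vcard B n = d) -> one_root_edge B -> (1 <= n)%N ->
  l1norm (mxprod (incidence R B d) 1 n) = l1norm (heights R B d n).
Proof.
move=> rankB rootB n1; rewrite l1norm_mul1 ?heights_mxprod //.
by apply: mxprod_ge0 => k i j; rewrite mxE ler0n.
Qed.

Lemma l1norm_heights (R : realType) (B : bratteli) d n :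
  l1norm (heights R B d n) = \sum_(w < d) (height B n w)%:R.
Proof. by apply: eq_bigr => w _; rewrite big_ord1 mxE ger0_norm. Qed.

(** * Positive infima of ratios *)

(** Trades the infimum for a uniform constant [c]. The set of ratios is bounded below by 0, and
    non-empty because [d > 0]. *)
Lemma inf_ratio_gt0P (R : realType) d (f : nat -> 'I_d -> R) :
  (0 < d)%N -> (forall n w, (1 <= n)%N -> 0 < f n w) ->
  0 < inf [set r | exists n (v w : 'I_d), (1 <= n)%N /\ r = f n v / f n w] <->
  exists2 c, 0 < c & forall n v w, (1 <= n)%N -> c * f n w <= f n v.
Proof.
move=> d0 f0; set A := (X in inf X); split => [infA|[c c0 cf]].
  exists (inf A) => // n v w n1; rewrite -ler_pdivlMr ?f0 //; apply: ge_inf.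
    by exists 0 => _ [k [a [b [k1 ->]]]]; rewrite divr_ge0 // ltW ?f0.
  by exists n, v, w.
apply: lt_le_trans c0 _; apply: lb_le_inf.
  pose i0 := Ordinal d0.
  by exists (f 1%N i0 / f 1%N i0), 1%N, i0, i0.
by move=> _ [k [a [b [k1 ->]]]]; rewrite ler_pdivlMr ?f0 // cf.
Qed.

(** From g(v) >= delta / f(v) and g(w) <= 1 / f(w) follows g(v) / g(w) >= delta f(w) / f(v) >= delta
    c. *)
Lemma inf_ratio_transfer (R : realType) d (f g : nat -> 'I_d -> R) delta :
  (0 < d)%N -> 0 < delta ->
  (forall n w, (1 <= n)%N -> 0 < f n w) ->
  (forall n w, (1 <= n)%N -> 0 < g n w) ->
  (forall n w, (1 <= n)%N -> delta <= f n w * g n w <= 1) ->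
  0 < inf [set r | exists n (v w : 'I_d), (1 <= n)%N /\ r = f n v / f n w] ->
  0 < inf [set r | exists n (v w : 'I_d), (1 <= n)%N /\ r = g n v / g n w].
Proof.
move=> d0 delta0 f0 g0 fg /(inf_ratio_gt0P d0 f0)[c c0 cf].
apply/(inf_ratio_gt0P d0 g0); exists (delta * c) => [|n v w n1].
  exact: mulr_gt0.
have /andP[lo _] := fg n v n1; have /andP[_ hi] := fg n w n1.
rewrite -(ler_pM2l (f0 n v n1)); apply: le_trans lo.
apply: (@le_trans _ _ (delta * (f n w * g n w))).
  have -> : f n v * (delta * c * g n w) = delta * (c * f n v * g n w).
    by rewrite mulrC -!mulrA; do 2 congr (_ * _); rewrite mulrC.
  by rewrite ler_pM2l // ler_pM2r ?g0 // cf.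
by rewrite ler_piMr // ltW.
Qed.

(** * Telescopings and convergent subsequences *)

Lemma telescoping_geq t : telescoping t -> forall n, (n <= t n)%N.
Proof. by move=> [_ _ tS]; elim=> // n IH; exact: leq_ltn_trans IH (tS n). Qed.

Lemma telescoping_cvg t : telescoping t -> t n @[n --> \oo] --> \oo.
Proof.
move=> tt A [N _ NA]; exists N => // n /= Nn; apply: NA => /=.
exact: leq_trans Nn (telescoping_geq tt n).
Qed.

(** Sequential compactness with the subsequence in the form of a telescoping: a cluster point [l] is
    approached along strictly increasing indices. *)
Lemma compact_telescoping (R : realType) (T : pseudoMetricType R) (A : set T)
    (u : nat -> T) :
  compact A -> (forall n, A (u n)) ->
  exists2 s, telescoping s & exists2 l, A l & u (s n) @[n --> \oo] --> l.
Proof.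
move=> cA uA.
have FA : (u n @[n --> \oo]) A by exists 0%N => // n _; exact: uA.
have [l [Al lu]] := cA (u n @[n --> \oo]) _ FA.
have next (N k : nat) : exists m, (N < m)%N /\ ball l k.+1%:R^-1 (u m).
  have [||_ [[m Nm <-] lm]] :=
    lu (u @` [set m | (N < m)%N]) (ball l k.+1%:R^-1).
  - by exists N.+1 => // m Nm; exists m.
  - by apply: nbhsx_ballx; rewrite invr_gt0 ltr0n.
  by exists m.
pose nxt N k := sval (cid (next N k)).
have nxtP N k : (N < nxt N k)%N /\ ball l k.+1%:R^-1 (u (nxt N k)).
  by rewrite /nxt; case: cid.
(* Levels 0 and 1 are forced, so the choice starts at index 2: [u (s k.+2)] lies within 1/(k+1) of
   [l]. This shift explains [N.+2] below. *)
pose s := fix s n := if n is (n'.+1 as n1).+1 then nxt (s n1) n' else n.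
exists s; first by split=> // -[//|k]; exact: (nxtP _ k).1.
exists l => //; apply/cvg_ballP => e e0.
have [N _ Ne] := near_infty_natSinv_lt (PosNum e0).
exists N.+2 => // -[//|[//|k]] /= Nk; apply: le_ball (nxtP _ k).2.
by apply/ltW/(Ne k).
Qed.

(** * Equivalence of the two bounds and the asymptotics *)

Unset Implicit Arguments.

Theorem proposition5p6 (R : realType) (d : nat) (B : bratteli)
    (rankB : forall n, (1 <= n)%N -> vcard B n = d)
    (rootB : one_root_edge B)
    (isolB : no_isolated_points B)
    (tailB : no_finite_tail_class B)
    (simpleB : simple_bratteli B)
    (uergB : uniquely_ergodic R B)
    (mu : probability (path_space B) R)
    (mu_inv : invariant_measure mu)
    (delta : R)
    (delta_gt0 : 0 < delta)
    (mu_tower : forall n (v : 'I_d), (1 <= n)%N ->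
       (delta%:E <= mu (tower B n v))%E) :
  let F := incidence R B d in
  (bounded_base_ratio d mu <-> bounded_height_ratio R B d) /\
  (bounded_base_ratio d mu \/ bounded_height_ratio R B d ->
   forall (t : nat -> nat) (xi : 'cV[R]_d),
     telescoping t ->
     (forall w, 0 <= xi w 0) ->
     \sum_w xi w 0 = 1 ->
     (forall n (x : 'cV[R]_d), (1 <= n)%N ->
        (forall w, 0 <= x w 0) -> x != 0 ->
        (fun m => let y := mxprod (telescoped F t) n m.+1 *m x in
                  (l1norm y)^-1 *: y) @ \oo --> xi) ->
     (forall w, 0 < xi w 0) /\
     exists s : nat -> nat, telescoping s /\
       let H := telescoped (telescoped F t) s in
       exists rho : 'cV[R]_d, (forall w, 0 < rho w 0) /\
         forall w : 'I_d,
           asymp_equiv (fun n => (height B (t (s n)) w)%:R)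
             (fun n => xi w 0 * l1norm (mxprod H 1 n)) /\
           asymp_equiv (fun n => base_mass mu (t (s n)) w)
             (fun n => rho w 0 / l1norm (mxprod H 1 n))).
Proof.
move=> F.
pose h n (w : 'I_d) : R := (height B n w)%:R.
pose p n (w : 'I_d) := base_mass mu n w.
(* An infinite path exists and meets V_1. *)
have d0 : (0 < d)%N.
  have [x _] := ipath_inhabited B.
  rewrite -(rankB 1%N isT).
  exact: leq_ltn_trans (leq0n _) (ltn_ord (level_vertex x 1)).
have hpE n (w : 'I_d) : (1 <= n)%N -> mu (tower B n w) = (h n w * p n w)%:E.
  by move=> n1; exact: mu_towerE (rankB n n1) mu_inv n1.
have hp n (w : 'I_d) : (1 <= n)%N -> delta <= h n w * p n w <= 1.
  move=> n1; rewrite -!lee_fin -hpE // mu_tower //=.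
  by rewrite probability_le1 //; exact: measurable_tower.
(* Neither factor of [h n w * p n w] can vanish, as the product is at least [delta]. *)
have h_gt0 n (w : 'I_d) : (1 <= n)%N -> 0 < h n w.
  move=> n1; rewrite lt_neqAle ler0n andbT eq_sym; apply/eqP => h0.
  by have := hp n w n1; rewrite h0 mul0r leNgt delta_gt0.
have p_gt0 n (w : 'I_d) : (1 <= n)%N -> 0 < p n w.
  move=> n1; rewrite -(pmulr_rgt0 _ (h_gt0 n w n1)).
  by apply: lt_le_trans delta_gt0 _; case/andP: (hp n w n1).
have base_height : bounded_base_ratio d mu <-> bounded_height_ratio R B d.
  split; apply: (inf_ratio_transfer d0 delta_gt0) => // n w n1.
  by rewrite mulrC hp.
split=> // bounded t xi tele_t xi0 xi1 xi_lim.
have /(inf_ratio_gt0P d0 h_gt0)[c c0 ch] : bounded_height_ratio R B d.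
  by case: bounded => // /base_height.
pose S n := l1norm (heights R B d n).
have S_gt0 n : (1 <= n)%N -> 0 < S n.
  move=> n1; rewrite /S l1norm_heights (bigD1 (Ordinal d0)) //=.
  by apply: ltr_wpDr; [apply: sumr_ge0 | exact: (h_gt0 n (Ordinal d0))].
have t1 m : (1 <= m)%N -> (1 <= t m)%N.
  by move=> m1; exact: leq_trans m1 (telescoping_geq tele_t m).
have SE m : (1 <= m)%N -> l1norm (mxprod (telescoped F t) 1 m) = S (t m).
  move=> m1; rewrite mxprod_telescoped //; case: (tele_t) => _ -> _.
  by rewrite l1norm_incidence // t1.
have h_lim (w : 'I_d) : h (t m) w / S (t m) @[m --> \oo] --> xi w 0.
  (* The hypothesis on [xi] is indexed by [m.+1]; it is applied from level 1 to the all-ones vector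
     and read at coordinate [w]. *)
  rewrite -cvg_shiftS.
  have x1 : const_mx 1 != 0 :> 'cV[R]_d.
    apply/eqP => /colP/(_ (Ordinal d0)); rewrite !mxE => /eqP.
    by rewrite oner_eq0.
  have x0 v : 0 <= (const_mx 1 : 'cV[R]_d) v 0 by rewrite mxE ler01.
  have hE m : h (t m.+1) w / S (t m.+1) =
      (let y := mxprod (telescoped F t) 1 m.+1 *m (const_mx 1 : 'cV[R]_d) in
       (l1norm y)^-1 *: y) w 0.
    rewrite mxprod_telescoped //; case: (tele_t) => _ -> _.
    by rewrite heights_mxprod ?t1 // !mxE mulrC.
  apply: cvg_trans (cvg_comp _ _ (xi_lim 1%N _ isT x0 x1)
    (@coord_continuous _ _ _ w 0 xi)).
  by apply: near_eq_cvg; near=> m; rewrite /= hE.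
have xi_gt0 w : 0 < xi w 0.
  (* Summing c h(v) <= h(w) over the [d] vertices [v] gives c S <= d h(w), so h(w) / S >= c / d,
     which survives the limit. *)
  apply: (@lt_le_trans _ _ (c / d%:R)); first by rewrite divr_gt0 // ltr0n.
  apply: (closed_cvg (fun y => c / d%:R <= y) _ _ _ (h_lim w)).
    exact: closed_ge.
  exists 1%N => // m /= m1.
  rewrite ler_pdivlMr ?S_gt0 ?t1 // mulrAC ler_pdivrMr ?ltr0n //.
  rewrite /S l1norm_heights mulr_sumr mulr_natr.
  apply: (@le_trans _ _ (\sum_(v < d) h (t m) w)); last first.
    by rewrite sumr_const card_ord.
  by apply: ler_sum => v _; exact/ch/t1.
split=> //.
(* Tower masses at level [t n]. The bounds [hp] start at level 1, so the value at 0 is set to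
   [delta] to keep [u] in the cube. *)
pose u n : 'rV[R]_d := \row_w (if n is 0 then delta else h (t n) w * p (t n) w).
have [||s tele_s [tau tau_ge u_lim]] := @compact_telescoping R _
  [set v : 'rV[R]_d | forall w, `[delta, 1]%classic (v 0 w)] u.
- exact: (@rV_compact R d (fun=> `[delta, 1]%classic)
    (fun=> @segment_compact R delta 1)).
- move=> n w; rewrite mxE /= in_itv /=; case: n => [|n]; last by rewrite hp ?t1.
  by rewrite lexx; case/andP: (hp 1%N w isT) => /le_trans; exact.
have s1 n : (1 <= n)%N -> (1 <= s n)%N.
  by move=> n1; exact: leq_trans n1 (telescoping_geq tele_s n).
have tau_gt0 w : 0 < tau 0 w.
  apply: lt_le_trans delta_gt0 _.
  by have := tau_ge w; rewrite /= in_itv /= => /andP[].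
exists s; split=> // H; exists (\col_w (tau 0 w / xi w 0)); split=> [w|w].
  by rewrite mxE divr_gt0.
have hs_lim : h (t (s n)) w / S (t (s n)) @[n --> \oo] --> xi w 0.
  exact: (cvg_comp _ _ (telescoping_cvg tele_s) (h_lim w)).
have us_lim : u (s n) 0 w @[n --> \oo] --> tau 0 w.
  exact: (cvg_comp _ _ u_lim (@coord_continuous _ _ _ 0 w tau)).
have HE n : (1 <= n)%N -> l1norm (mxprod H 1 n) = S (t (s n)).
  move=> n1; rewrite mxprod_telescoped //; case: (tele_s) => _ -> _.
  by rewrite SE // s1.
split; rewrite /asymp_equiv.
  have lim1 : h (t (s n)) w / S (t (s n)) / xi w 0 @[n --> \oo] --> (1 : R).
    rewrite -[X in _ --> X](divff (lt0r_neq0 (xi_gt0 w))).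
    exact: cvgM hs_lim (cvg_cst _).
  (* [HE] is available for indices at least 1, hence an eventual equality. *)
  apply: cvg_trans lim1; apply: near_eq_cvg; near=> n => /=.
  rewrite HE; last by near: n; exists 1%N.
  by rewrite invfM [_^-1 * _]mulrC mulrA.
rewrite mxE.
(* Tower mass divided by h / S is base mass times S, with limit tau / xi. *)
have lim1 : u (s n) 0 w / (h (t (s n)) w / S (t (s n))) / (tau 0 w / xi w 0)
    @[n --> \oo] --> (1 : R).
  rewrite -[X in _ --> X](divff (lt0r_neq0 (divr_gt0 (tau_gt0 w) (xi_gt0 w)))).
  apply: cvgM (cvg_cst _).
  exact: cvgM us_lim (cvgV (lt0r_neq0 (xi_gt0 w)) hs_lim).
apply: cvg_trans lim1; apply: near_eq_cvg; near=> n => /=.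
have n1 : (1 <= n)%N by near: n; exists 1%N.
(* Since [s n] is positive, [u (s n)] is a true tower mass and not the default. *)
rewrite HE // mxE; have := s1 n n1; case: (s n) => // k _.
have hn0 := lt0r_neq0 (h_gt0 (t k.+1) w (t1 k.+1 isT)).
rewrite !invf_div [RHS]mulrA; congr (_ * _).
by rewrite [h _ _ * _]mulrC mulrACA divff ?mulr1.
Unshelve. all: by end_near. Qed.
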